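(* Let $\mathcal A=\{A_1,\dots,A_m\}$ be a finite family of real $d\times d$ matrices that is irreducible, normalized so that $\rho(\mathcal A)=1$, and has finitely many dominant products. Suppose the leading eigenvalues of all dominant products are unique and simple. Then all trajectories of the switching system $x(k+1)=A(k)x(k)$, $A(k)\in\mathcal A$, converge to zero as $k\to\infty$, apart from those corresponding to eventually periodic switching laws with a period equal to a dominant product.
   Context: A switching law is a sequence $A(\cdot)$ of matrices from $\mathcal A$ (repetitions permitted); together with an initial point $x_0\in\mathbb R^d$ it defines a trajectory $\{x(k)\}_{k\ge0}$ by $x(0)=x_0$, $x(k+1)=A(k)x(k)$. A switching law given by a sequence of indices $s_1s_2\dots$ (the $j$th matrix applied is $A_{s_j}$) is eventually periodic with a period equal to a dominant product if there are $n,N$ such that $s_k=s_{k+n}$ for all $k>N$ and the product $A_{s_{N+n}}\cdots A_{s_{N+1}}$ is a dominant product. $\mathcal A$ is irreducible if the matrices $A_i$ share no common invariant linear subspace other than $\{0\}$ and $\mathbb R^d$. $\mathcal A^n$ is the set of all products of $n$ matrices from $\mathcal A$, $\mathcal A^{\mathbb N}=\bigcup_{n\ge1}\mathcal A^n$; products are regarded as words, $|\Pi|$ is the length of $\Pi$. $\rho(S)$ is the spectral radius of a matrix; $\rho(\mathcal A)=\lim_{n\to\infty}\max_{\Pi\in\mathcal A^n}\|\Pi\|^{1/n}$ is the joint spectral radius; $\nu(\Pi)=\rho(\Pi)^{1/|\Pi|}$. A product is primitive if it is not a power of a shorter product. A set $\mathcal P\subset\mathcal A^{\mathbb N}$ is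 a set of dominant products if: (1) all its elements are primitive and none is a cyclic permutation of another; (2) there is $q$ with $\nu(\Pi)=q$ for all $\Pi\in\mathcal P$; (3) there is $\varepsilon>0$ such that every $S\in\mathcal A^{\mathbb N}$ satisfies $\nu(S)\le(1-\varepsilon)^{1/|S|}q$ unless $S$ is a power of some product from $\mathcal P$ or of one of its cyclic permutations. $\mathcal A$ has finitely many dominant products if it has a finite set of dominant products. A leading eigenvalue is an eigenvalue of largest modulus; it is unique and simple if it is not multiple and all other eigenvalues, except for $\bar\lambda$ when $\lambda\notin\mathbb R$, are strictly smaller in modulus. *)

(* Defs.v *)
From mathcomp Require Import all_boot all_order all_algebra.
From mathcomp Require Import complex.
From mathcomp Require Import all_classical all_reals all_analysis.

Set Implicit Arguments.
Unset Strict Implicit.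
Unset Printing Implicit Defensive.

Import Order.TTheory GRing.Theory Num.Theory.
Import numFieldNormedType.Exports.

Local Open Scope classical_set_scope.
Local Open Scope ring_scope.

Definition irreducible_family (R : realType) (m d : nat)
    (A : 'I_m -> 'M[R]_d) : Prop :=
  forall V : {vspace 'cV[R]_d},
    (forall i v, v \in V -> A i *m v \in V) -> V = 0%VS \/ V = fullv.

(* A product is encoded by the word of its indices in order of application:
   [:: s1; ...; sn] stands for A_sn *m ... *m A_s1. *)
Definition word_prod (R : realType) (m d : nat) (A : 'I_m -> 'M[R]_d)
    (w : seq 'I_m) : 'M[R]_d :=
  foldr (fun i M => M *m A i) 1%:M w.

Definition complex_eigenvalue (R : realType) (d : nat) (M : 'M[R]_d)
    (l : R[i]) : bool :=
  eigenvalue (map_mx (real_complex R) M) l.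

Definition cmod (R : realType) (z : R[i]) : R := ComplexField.Normc.normc z.

Definition spectral_radius (R : realType) (d : nat) (M : 'M[R]_d) : R :=
  sup [set cmod l | l in [set l : R[i] | complex_eigenvalue M l]].

(* `|_| on matrices is the largest modulus of an entry; the limit does not
   depend on the choice of the norm. *)
Definition joint_spectral_radius (R : realType) (m d : nat)
    (A : 'I_m -> 'M[R]_d) : R :=
  lim ((fun n : nat => \big[Num.max/0]_(w : n.-tuple 'I_m)
          (`| word_prod A w | `^ (n%:R)^-1)) @ \oo).

Definition averaged_radius (R : realType) (m d : nat) (A : 'I_m -> 'M[R]_d)
    (w : seq 'I_m) : R :=
  spectral_radius (word_prod A w) `^ ((size w)%:R)^-1.

Definition word_power (T : Type) (w : seq T) (k : nat) : seq T :=
  flatten (nseq k w).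

Definition primitive_word (T : Type) (w : seq T) : Prop :=
  ~ exists u : seq T, exists k : nat, (size u < size w)%N /\ w = word_power u k.

(* P is required to be nonempty: the empty set would satisfy the other clauses
   for every large enough q.  The bound e < 1 keeps (1 - e) `^ _ meaningful and
   loses nothing, as the last clause persists when e decreases. *)
Definition dominant_set (R : realType) (m d : nat) (A : 'I_m -> 'M[R]_d)
    (P : set (seq 'I_m)) : Prop :=
  [/\ P !=set0,
      forall w, P w -> w <> [::],
      forall w, P w -> primitive_word w,
      forall u w, P u -> P w -> u <> w -> forall k, u <> rot k w
    & exists q : R,
        (forall w, P w -> averaged_radius A w = q) /\
        exists e : R, 0 < e < 1 /\
          forall S : seq 'I_m, S <> [::] ->
            ~ (exists w, exists j, exists k,
                 P w /\ S = word_power (rot j w) k) ->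
            averaged_radius A S <= (1 - e) `^ ((size S)%:R)^-1 * q].

Definition leading_eigenvalue (R : realType) (d : nat) (M : 'M[R]_d)
    (l : R[i]) : Prop :=
  complex_eigenvalue M l /\
  forall l', complex_eigenvalue M l' -> cmod l' <= cmod l.

(* For real l the conjugate is l itself, so that the exception made for it is
   effective only when l is not real. *)
Definition unique_simple_leading (R : realType) (d : nat) (M : 'M[R]_d)
    (l : R[i]) : Prop :=
  mup l (char_poly (map_mx (real_complex R) M)) = 1%N /\
  forall l', complex_eigenvalue M l' -> l' <> l -> l' <> conjc l ->
    cmod l' < cmod l.

Fixpoint trajectory (R : realType) (m d : nat) (A : 'I_m -> 'M[R]_d)
    (s : nat -> 'I_m) (x0 : 'cV[R]_d) (k : nat) : 'cV[R]_d :=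
  if k is k'.+1 then A (s k') *m trajectory A s x0 k' else x0.

Definition eventually_periodic_in (m : nat) (P : set (seq 'I_m))
    (s : nat -> 'I_m) : Prop :=
  exists n N : nat,
    (forall k, (N <= k)%N -> s k = s (k + n)%N) /\
    P (mkseq (fun i => s (N + i)%N) n).

(* Main.v *)
Require Import Defs.
From mathcomp Require Import all_boot all_order all_fingroup all_algebra.
From mathcomp Require Import complex.
From mathcomp Require Import all_classical all_reals all_analysis.
Import Order.TTheory GRing.Theory Num.Theory.
Import numFieldNormedType.Exports.
Local Open Scope classical_set_scope.
Local Open Scope ring_scope.

(* Irreducibility and joint spectral radius 1 make all products uniformly
   bounded: the vectors with bounded orbit form an invariant subspace; were it
   zero, compactness of the unit sphere would give N such that every vector is
   expanded 4 times by some product of length at most N, hence exponential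
   growth of the products.

   If a trajectory does not tend to 0, it returns infinitely often near some
   z <> 0, so each product B read between two such returns almost fixes a
   vector that is not small.  Multiplying by the adjugate of B - 1, which is
   uniformly bounded, det (B - 1) is small, so B has an eigenvalue close to 1
   and its spectral radius exceeds 1 - e.  By dominance B is a power of a cyclic
   permutation of a dominant product.  There are finitely many of these, so, with
   the first return fixed, one of them serves for arbitrarily late second
   returns, and the switching law is periodic from the first return on. *)

(** * Entrywise norm estimates for products, determinants and adjugates *)

Lemma ler_mx_norm_entry (R : realType) m n (M : 'M[R]_(m, n)) i j :
  `|M i j| <= `|M|.
Proof.
rewrite [leRHS]/Num.Def.normr /= mx_normrE.
by apply/bigmax_geP; right; exists (i, j).
Qed.

Lemma mx_norm_le (R : realType) m n (M : 'M[R]_(m, n)) c :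
  0 <= c -> (forall i j, `|M i j| <= c) -> `|M| <= c.
Proof.
move=> c0 Mc; rewrite [leLHS]/Num.Def.normr /= mx_normrE.
by apply/bigmax_leP; split=> // -[i j] _.
Qed.

Lemma ler_norm_mulmx (R : realType) m n p (M : 'M[R]_(m, n)) (N : 'M[R]_(n, p)) :
  `|M *m N| <= n%:R * (`|M| * `|N|).
Proof.
apply: mx_norm_le => [|i j]; first by rewrite !mulr_ge0.
rewrite mxE (le_trans (ler_norm_sum _ _ _))//.
rewrite mulr_natl -[n in _ *+ n]card_ord -sumr_const.
by apply: ler_sum => k _; rewrite normrM ler_pM// ler_mx_norm_entry.
Qed.

Lemma ler_norm_det (R : realType) n (M : 'M[R]_n) c :
  (forall i j, `|M i j| <= c) -> `|\det M| <= n`!%:R * c ^+ n.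
Proof.
move=> Mc; rewrite /determinant (le_trans (ler_norm_sum _ _ _))//.
rewrite mulr_natl -card_Sn -sumr_const; apply: ler_sum => s _.
rewrite normrM normrX normrN1 expr1n mul1r normr_prod.
rewrite -[n in c ^+ n]card_ord -prodr_const.
by apply: ler_prod => i _; rewrite normr_ge0 Mc.
Qed.

Lemma ler_norm_adj (R : realType) n (M : 'M[R]_n) c :
  0 <= c -> `|M| <= c -> `|\adj M| <= n.-1`!%:R * c ^+ n.-1.
Proof.
move=> c0 Mc; apply: mx_norm_le => [|i j]; first by rewrite mulr_ge0// exprn_ge0.
rewrite mxE /cofactor normrM normrX normrN1 expr1n mul1r.
apply: ler_norm_det => k l; rewrite !mxE.
exact: le_trans (ler_mx_norm_entry _ _ _ _ _ _) Mc.
Qed.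

(** With [N = M - 1%:M], the identity [\adj N *m N = (\det N)%:M] gives
    [\det N *: z = \adj N *m (M *m z - z)]. *)
Lemma det_sub1_almost_fixed (R : realType) n (M : 'M[R]_n) (z : 'cV[R]_n) c :
  `|M - 1%:M| <= c ->
  `|\det (M - 1%:M)| * `|z| <=
    n%:R * (n.-1`!%:R * c ^+ n.-1) * `|M *m z - z|.
Proof.
move=> Mc; have c0 : 0 <= c by exact: le_trans Mc.
have -> : M *m z - z = (M - 1%:M) *m z by rewrite mulmxBl mul1mx.
rewrite -mx_normZ -mul_scalar_mx -mul_adj_mx -mulmxA.
apply: le_trans (ler_norm_mulmx _ _ _ _ _ _) _.
by rewrite -mulrA ler_wpM2l// ler_wpM2r// ler_norm_adj.
Qed.

(** * Complex eigenvalues and the spectral radius *)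

Lemma cmodE (R : realType) (z : R[i]) : `|z| = (cmod z)%:C%C.
Proof. by []. Qed.

Lemma cmod_ge0 (R : realType) (z : R[i]) : 0 <= cmod z.
Proof. by rewrite -lecR; exact: (normr_ge0 z). Qed.

Lemma cmodM (R : realType) : {morph @cmod R : x y / x * y}.
Proof. exact: ComplexField.Normc.normcM. Qed.

Lemma cmod1 (R : realType) : cmod (1 : R[i]) = 1.
Proof. exact: ComplexField.Normc.normc1. Qed.

Lemma cmodX (R : realType) (z : R[i]) n : cmod (z ^+ n) = cmod z ^+ n.
Proof. by elim: n => [|n IH]; rewrite ?cmod1// !exprS cmodM IH. Qed.

Lemma cmod_real (R : realType) (x : R) : cmod x%:C%C = `|x|.
Proof. by rewrite /cmod /= expr0n addr0 sqrtr_sqr. Qed.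

Lemma ler_cmod_sum (R : realType) (I : finType) (F : I -> R[i]) :
  cmod (\sum_i F i) <= \sum_i cmod (F i).
Proof.
rewrite -lecR -cmodE (le_trans (ler_norm_sum _ _ _))//.
by rewrite rmorph_sum.
Qed.

(** The eigenvalue equation is read at a coordinate of the eigenvector of largest modulus. *)
Lemma cmod_eigenvalue_le (R : realType) n (M : 'M[R]_n) l :
  complex_eigenvalue M l -> cmod l <= n%:R * `|M|.
Proof.
move=> /eigenvalueP[v vM v0].
have [j0 vj0] : exists j, v 0 j != 0 by apply/rV0Pn.
have [/= j _ jmax] := @Order.TotalTheory.arg_maxP _ R _ j0 predT (fun j => cmod (v 0 j)) isT.
have vj : 0 < cmod (v 0 j).
  apply: lt_le_trans (jmax j0 isT).
  by rewrite -ltcR -cmodE normr_gt0.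
rewrite -(ler_pM2r vj) -cmodM.
have <- : (v *m map_mx (real_complex R) M) 0 j = l * v 0 j by rewrite vM mxE.
rewrite mxE (le_trans (ler_cmod_sum _ _ _))//.
rewrite -mulrA mulr_natl -[n in _ *+ n]card_ord -sumr_const.
apply: ler_sum => k _; rewrite cmodM mxE cmod_real mulrC.
by rewrite ler_pM// ?cmod_ge0 ?ler_mx_norm_entry ?jmax.
Qed.

(** [W k] stands for the [k]th power of [M]; the recursion lets products of repeated words take its
    place directly. *)
Lemma complex_eigenvalueX (R : realType) n (M : 'M[R]_n) l (W : nat -> 'M[R]_n) k :
  W 0 = 1%:M -> (forall j, W j.+1 = M *m W j) ->
  complex_eigenvalue M l -> complex_eigenvalue (W k) (l ^+ k).
Proof.
move=> W0 WS /eigenvalueP[v vM v0]; apply/eigenvalueP; exists v => //.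
elim: k => [|k IH]; first by rewrite W0 map_mx1 mulmx1 scale1r.
by rewrite WS map_mxM mulmxA vM -scalemxAl IH scalerA exprS.
Qed.

Lemma cmod_le_spectral_radius (R : realType) n (M : 'M[R]_n) l :
  complex_eigenvalue M l -> cmod l <= spectral_radius M.
Proof.
move=> Ml; apply: sup_upper_bound; last by exists l.
split; first by exists (cmod l), l.
by exists (n%:R * `|M|) => _ [l' /= Ml' <-]; exact: cmod_eigenvalue_le.
Qed.

Lemma spectral_radius_le (R : realType) n (M : 'M[R]_n) c :
  0 <= c -> (forall l, complex_eigenvalue M l -> cmod l <= c) ->
  spectral_radius M <= c.
Proof.
move=> c0 Mc; rewrite /spectral_radius; set E := [set _ | _ in _].
(* For [n = 0] there is no eigenvalue and the supremum is 0 by default, whence the assumption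
   [0 <= c]. *)
have [->|/set0P E0] := eqVneq E set0; first by rewrite sup0.
by apply: ge_sup => // _ [l /= Ml <-]; exact: Mc.
Qed.

Lemma horner_char_poly (F : comNzRingType) n (M : 'M[F]_n) x :
  (char_poly M).[x] = \det (x%:M - M).
Proof.
rewrite -horner_evalE /char_poly -det_map_mx; congr (\det _).
by apply/matrixP => i j; rewrite !mxE /= horner_evalE hornerD hornerN hornerC hornerMn hornerX.
Qed.

(** Up to sign, [\det (M - 1%:M)] is the product of [1 - l] over the complex eigenvalues with
    multiplicity. Were every factor at least [e] in modulus, the product would be at least
    [e ^+ n]. *)
Lemma complex_eigenvalue_near1 (R : realType) n (M : 'M[R]_n) e :
  0 <= e -> `|\det (M - 1%:M)| < e ^+ n ->
  exists2 l, complex_eigenvalue M l & 1 - e < cmod l.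
Proof.
move=> e0 detM; apply: contrapT => noM.
have far l : complex_eigenvalue M l -> e <= cmod (1 - l).
  move=> Ml; rewrite leNgt; apply/negP => le; apply: noM; exists l => //.
  rewrite ltrBlDr addrC -ltrBlDr; apply: le_lt_trans le.
  rewrite lerBlDr -lecR rmorphD /= -!cmodE -[1 in leLHS]cmod1.
  by rewrite -cmodE -[X in `|X|](subrK l) ler_normD.
pose Mc := map_mx (real_complex R) M.
have [r rE] := closed_field_poly_normal (char_poly Mc).
rewrite (monicP (char_poly_monic _)) scale1r in rE.
have szr : size r = n.
  have := size_char_poly Mc; rewrite rE size_prod_XsubC; by case.
have : cmod (char_poly Mc).[1] = `|\det (M - 1%:M)|.
  rewrite horner_char_poly -cmod_real -opprB.
  rewrite -(map_mx1 (real_complex R)) -map_mxB -[- map_mx _ _]scaleN1r detZ det_map_mx.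
  rewrite cmodM cmodX.
  have -> : (-1 : R[i]) = (-1)%:C%C by rewrite rmorphN rmorph1.
  by rewrite cmod_real normrN1 expr1n mul1r.
move=> detE; move: detM; rewrite ltNge => /negP; apply.
rewrite -detE rE horner_prod -szr.
have : forall l, l \in r -> e <= cmod (1 - l).
  move=> l lr; apply: far; rewrite /complex_eigenvalue eigenvalue_root_char.
  by rewrite -/Mc rE root_prod_XsubC.
elim: (r) => [|l r' IH] rfar; first by rewrite big_nil cmod1.
rewrite big_cons cmodM /= exprS hornerXsubC ler_pM ?exprn_ge0//.
  by rewrite rfar ?mem_head.
by apply: IH => l' lr'; rewrite rfar// inE lr' orbT.
Qed.

(** Bolzano-Weierstrass along the indices satisfying [Q], applied to the transposed vectors in a
    compact box of rows. *)
Lemma cluster_subseq (R : realType) n (x : nat -> 'cV[R]_n) (Q : nat -> Prop) c :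
  (forall k, `|x k| <= c) -> (forall N, exists2 k, (N <= k)%N & Q k) ->
  exists z, forall e N, 0 < e -> exists k, [/\ (N <= k)%N, Q k & `|x k - z| < e].
Proof.
move=> xc Qinf.
have /choice[f Qf] N : exists k, (N <= k)%N /\ Q k.
  by have [k] := Qinf N; exists k.
pose B : set 'rV[R]_n := [set v | forall i, v ord0 i \in `[- c, c]].
have cB : compact B.
  by apply: (@rV_compact _ _ (fun=> `[- c, c]%classic)) => _; exact: segment_compact.
have [|z [_ zP]] := cB ((fun k => (x (f k))^T) @ \oo) _.
  exists 0%N => // k _ /= i; rewrite mxE in_itv /= -ler_norml.
  exact: le_trans (ler_mx_norm_entry _ _ _ _ _ _) (xc _).
exists z^T => e N e0.
have [_ [[k /= Nk <-]]] := zP [set (x (f k))^T | k in [set k | (N <= k)%N]] (ball z e)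
  (ex_intro2 _ _ N I (fun k Nk => ex_intro2 _ _ k Nk erefl)) (nbhsx_ballx _ _ e0).
rewrite -ball_normE /= => zx; exists (f k); split.
- exact: leq_trans Nk (Qf k).1.
- exact: (Qf k).2.
- rewrite distrC; apply: le_lt_trans zx.
  apply: mx_norm_le => // i j.
  have := ler_mx_norm_entry _ _ _ (z - (x (f k))^T) j i.
  by rewrite !mxE.
Qed.

(** * Uniform boundedness of all products *)

Lemma word_prod_cat (R : realType) m d (A : 'I_m -> 'M[R]_d) u v :
  word_prod A (u ++ v) = word_prod A v *m word_prod A u.
Proof.
elim: u => [|i u IH]; first by rewrite mulmx1.
by rewrite cat_cons /= IH mulmxA.
Qed.

(** A subspace of maximal dimension inside [B] exhausts [B]: adjoining a vector of [B] stays inside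
    [B], so it cannot raise the dimension. *)
Lemma maximal_vspace (F : fieldType) (E : vectType F) (B : E -> Prop) :
  B 0 -> (forall a u v, B u -> B v -> B (a *: u + v)) ->
  exists V : {vspace E}, forall v, v \in V <-> B v.
Proof.
move=> B0 Blin.
pose ok k := `[< exists V : {vspace E}, \dim V = k /\ forall v, v \in V -> B v >].
have ex_ok : exists k, ok k.
  exists 0%N; apply/asboolP; exists 0%VS; split; first exact: dimv0.
  by move=> v; rewrite memv0 => /eqP ->.
have ok_le k : ok k -> (k <= \dim {:E})%N.
  by move=> /asboolP[V [<- _]]; apply: dimvS; exact: subvf.
have [k /asboolP[V [dimV VB]] kmax] := ex_maxnP ex_ok ok_le.
exists V => v; split=> [/VB//|Bv].
suff: (V + <[v]> <= V)%VS by rewrite subv_add => /andP[_]; rewrite -memvE.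
have okW : ok (\dim (V + <[v]>)).
  apply/asboolP; exists (V + <[v]>)%VS; split=> // _ /memv_addP[u /VB Bu [w /vlineP[a ->] ->]].
  by rewrite addrC; exact: Blin.
rewrite -(geq_leqif (dimv_leqif_sup (addvSl V <[v]>))) dimV; exact: kmax.
Qed.

Section Boundedness.
Context {R : realType} {m d : nat} (A : 'I_m -> 'M[R]_d).

Definition bounded_orbit (x : 'cV[R]_d) :=
  exists c, forall w, `|word_prod A w *m x| <= c.

Lemma bounded_orbit_vspace :
  exists V : {vspace 'cV[R]_d}, forall v, v \in V <-> bounded_orbit v.
Proof.
apply: maximal_vspace => [|a u v [cu uc] [cv vc]].
  by exists 0 => w; rewrite mulmx0 normr0.
exists (`|a| * cu + cv) => w; rewrite mulmxDr -scalemxAr.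
by rewrite (le_trans (ler_normD _ _))// lerD// mx_normZ ler_wpM2l.
Qed.

Lemma bounded_orbit_mul x i : bounded_orbit x -> bounded_orbit (A i *m x).
Proof. by move=> [c xc]; exists c => w; rewrite mulmxA; exact: (xc (i :: w)). Qed.

(** The columns of a product are the images of the finitely many basis vectors. *)
Lemma bounded_products_of_orbits : (forall x, bounded_orbit x) ->
  exists c, forall w, `|word_prod A w| <= c.
Proof.
move=> bnd; have /choice[c cP] j := bnd (delta_mx j 0).
have c0 j : 0 <= c j by exact: le_trans (cP j [::]).
exists (\sum_j c j) => w; apply: mx_norm_le => [|i j]; first exact: sumr_ge0.
have -> : word_prod A w i j = (word_prod A w *m delta_mx j (0 : 'I_1)) i 0.
  by rewrite -colE mxE.
rewrite (le_trans (ler_mx_norm_entry _ _ _ _ _ _))// (le_trans (cP j w))//.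
by rewrite (bigD1 j)//= lerDl sumr_ge0.
Qed.

(** Otherwise each [N] has a unit vector [y N] expanded at most 4 times by every word of length at
    most [N]. A cluster point of these has a bounded orbit, hence is 0, yet it is a limit of unit
    vectors. *)
Lemma uniform_expansion : (forall x, bounded_orbit x -> x = 0) ->
  exists N, forall x : 'cV[R]_d, exists w, (size w <= N)%N /\ 4 * `|x| <= `|word_prod A w *m x|.
Proof.
move=> unb; apply: contrapT => noN.
have /choice[y yP] N : exists y : 'cV[R]_d, `|y| = 1 /\
    forall w, (size w <= N)%N -> `|word_prod A w *m y| <= 4.
  apply: contrapT => noy; apply: noN; exists N => x.
  have [->|x0] := eqVneq x 0; first by exists [::]; rewrite mulmx0 normr0 mulr0.
  have nx : 0 < `|x| by rewrite normr_gt0.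
  apply: contrapT => now; apply: noy; exists (`|x|^-1 *: x); split.
    by rewrite mx_normZ normfV normr_id mulVf// gt_eqF.
  move=> w wN; rewrite -scalemxAr mx_normZ normfV normr_id mulrC ler_pdivrMr//.
  by rewrite leNgt; apply/negP => /ltW le4; apply: now; exists w.
have y1 k : `|y k| <= 1 by rewrite (yP k).1.
have [z zP] := cluster_subseq _ _ y (fun=> True) 1 y1
  (fun N => ex_intro2 _ _ N (leqnn N) I).
have z0 : z = 0.
  apply: unb; exists 5 => w.
  (* This [e] keeps the error [word_prod A w *m (y k - z)] at most 1, so 5 = 4 + 1; the bound 4
     applies because [k] is at least [size w]. *)
  pose e := (d%:R * `|word_prod A w| + 1)^-1.
  have e0 : 0 < e by rewrite invr_gt0 ltr_wpDl// mulr_ge0.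
  have [k [wk _ yz]] := zP e (size w) e0.
  have -> : word_prod A w *m z = word_prod A w *m y k - word_prod A w *m (y k - z).
    by rewrite mulmxBr opprB addrC subrK.
  rewrite (le_trans (ler_normB _ _))// (_ : 5 = 4 + 1); last by rewrite -(natrD _ 4 1).
  rewrite lerD ?(yP k).2// (le_trans (ler_norm_mulmx _ _ _ _ _ _))//.
  rewrite mulrA (le_trans (ler_wpM2l _ (ltW yz))) ?mulr_ge0//.
  by rewrite ler_pdivrMr ?mul1r ?lerDl// -invr_gt0.
have [k [_ _]] := zP 1 0%N ltr01.
by rewrite z0 subr0 (yP k).1 ltxx.
Qed.

Lemma iterated_expansion N (x : 'cV[R]_d) :
  (forall x : 'cV[R]_d, exists w, (size w <= N)%N /\ 4 * `|x| <= `|word_prod A w *m x|) ->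
  forall k, exists w, (size w <= k * N)%N /\ 4 ^+ k * `|x| <= `|word_prod A w *m x|.
Proof.
move=> expN; elim=> [|k [w [wk xw]]].
  by exists [::]; rewrite expr0 mul1r mul1mx.
have [v [vN wv]] := expN (word_prod A w *m x).
exists (w ++ v); rewrite size_cat mulSn addnC leq_add// word_prod_cat -mulmxA.
by split=> //; rewrite exprS -mulrA (le_trans _ wv)// ler_wpM2l.
Qed.

Lemma joint_spectral_radius_growth r : joint_spectral_radius A = 1 -> 1 < r ->
  exists c, forall w, `|word_prod A w| <= c * r ^+ size w.
Proof.
move=> rho1 r1.
pose f (n : nat) := \big[Num.max/0]_(w : n.-tuple 'I_m)
          (`| word_prod A w | `^ (n%:R)^-1).
(* The limit of a divergent sequence is 0 by default, so its being 1 forces convergence. *)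
have fcvg : f @ \oo --> (1 : R).
  rewrite -rho1; apply: contrapT => /dvgP fd.
  move: rho1; rewrite /joint_spectral_radius -/f fd => /eqP.
  by rewrite eq_sym oner_eq0.
have /cvgrPdist_lt/(_ (r - 1)) := fcvg.
rewrite subr_gt0 => /(_ r1)[N _ fN].
have r0 : 0 <= r by rewrite (le_trans ler01)// ltW.
(* The bound [maxn N 1] excludes the empty word, for which the root cannot be undone; shorter words
   are absorbed into the constant [c] below. *)
have long w : (maxn N 1 <= size w)%N -> `|word_prod A w| <= r ^+ size w.
  rewrite geq_max => /andP[/fN /= fw w0].
  have : `|word_prod A w| `^ (size w)%:R^-1 <= r.
    apply: (@le_trans _ _ (f (size w))).
      by apply/bigmax_geP; right; exists (in_tuple w).
    by rewrite -(subrK 1 r) -lerBlDr (le_trans (ler_norm _))// distrC ltW.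
  move=> /(@ge0_ler_powR _ (size w)%:R (ler0n _ _)).
  rewrite !nnegrE powR_ge0 r0 -powRrM mulVf ?powRr1 ?powR_mulrn//; first exact.
  by rewrite pnatr_eq0 -lt0n.
pose c := \sum_(n < maxn N 1) \sum_(w : n.-tuple 'I_m) `|word_prod A w|.
have c0 : 0 <= c by rewrite sumr_ge0// => n _; rewrite sumr_ge0.
exists (1 + c) => w.
have rw : 1 <= r ^+ size w by rewrite exprn_ege1// ltW.
case: (leqP (maxn N 1) (size w)) => [/long wr|wN].
  by rewrite (le_trans wr)// ler_peMl ?exprn_ge0// lerDl.
apply: (@le_trans _ _ ((1 + c) * 1)); last by rewrite ler_wpM2l// addr_ge0.
rewrite mulr1 /c (bigD1 (Ordinal wN))//= (bigD1 (in_tuple w))//=.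
by rewrite addrCA -!addrA lerDl !addr_ge0 ?sumr_ge0// => n _; rewrite sumr_ge0.
Qed.

Lemma bounded_products : irreducible_family A -> joint_spectral_radius A = 1 ->
  exists c, forall w, `|word_prod A w| <= c.
Proof.
move=> irr rho1; have [V VP] := bounded_orbit_vspace.
case: (irr V) => [i v /VP Bv|V0|Vf]; first exact/VP/bounded_orbit_mul.
  have unb x : bounded_orbit x -> x = 0.
    by move/VP; rewrite V0 memv0 => /eqP.
  case: (pselect (forall x : 'cV[R]_d, x = 0)) => [all0|].
    by apply: bounded_products_of_orbits => x; rewrite (all0 x); apply/VP; exact: mem0v.
  move=> /existsNP[x /eqP x0].
  have [N expN] := uniform_expansion unb.
  (* As [r ^+ N.+1 = 2], words of length at most [k * N] have products of norm at most [c * 2 ^+ k],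
     too little for an expansion by [4 ^+ k]. *)
  pose r : R := 2 `^ (N.+1)%:R^-1.
  have rS : r ^+ N.+1 = 2.
    by rewrite -powR_mulrn ?powR_ge0// -powRrM mulVf ?powRr1// pnatr_eq0.
  have r1 : 1 < r.
    rewrite ltNge; apply/negP => /(exprn_ile1 N.+1 (powR_ge0 _ _)).
    by rewrite -/r rS (ler_nat R 2 1).
  have rN : r ^+ N <= 2 by rewrite -rS ler_eXn2l.
  have [c cP] := joint_spectral_radius_growth r rho1 r1.
  have c0 : 0 <= c.
    by have := cP [::]; rewrite expr0 mulr1; exact: le_trans.
  pose K := d%:R * c; have K0 : 0 <= K by rewrite mulr_ge0.
  (* This number [k] of iterations satisfies [K < 2 ^+ k], which contradicts
     [4 ^+ k <= K * 2 ^+ k]. *)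
  have [w [wk]] := iterated_expansion N x expN (Num.bound K).
  set k := Num.bound K in wk *.
  have Kk : K < 2 ^+ k.
    rewrite (lt_trans (archi_boundP K0))// -/k -natrX ltr_nat ltn_expl//.
  have wxK : `|word_prod A w *m x| <= K * 2 ^+ k * `|x|.
    rewrite (le_trans (ler_norm_mulmx _ _ _ _ _ _))// mulrA ler_wpM2r//.
    rewrite -mulrA ler_wpM2l// (le_trans (cP w))// ler_wpM2l//.
    apply: (@le_trans _ _ (r ^+ (k * N))); first by rewrite ler_eXn2l.
    by rewrite mulnC exprM lerXn2r// nnegrE ?exprn_ge0 ?powR_ge0.
  move=> /le_trans/(_ wxK); rewrite ler_pM2r ?normr_gt0//.
  have -> : (4 : R) = 2 * 2 by rewrite -(natrM _ 2 2).
  by rewrite exprMn ler_pM2r ?exprn_gt0// leNgt Kk.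
by apply: bounded_products_of_orbits => x; apply/VP; rewrite Vf memvf.
Qed.

End Boundedness.

(** * Factors of switching laws, rotations and periods *)

Lemma seq_pigeonhole {T : eqType} (us : seq T) (Q : T -> nat -> Prop) :
  (forall N, exists2 n, (N <= n)%N & exists2 u, u \in us & Q u n) ->
  exists2 u, u \in us & forall N, exists2 n, (N <= n)%N & Q u n.
Proof.
move=> Qinf; apply: contrapT => noQ.
have /choice[f fP] u : exists N, u \in us -> forall n, (N <= n)%N -> ~ Q u n.
  apply: contrapT => noN; apply: noQ; exists u.
    by apply: contrapT => uus; apply: noN; exists 0%N.
  move=> N; apply: contrapT => non; apply: noN; exists N => _ n Nn Qun.
  by apply: non; exists n.
have [n fn [u uus]] := Qinf (\max_(u <- us) f u).
by apply: fP => //; apply: leq_trans fn; exact: leq_bigmax_seq.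
Qed.

Definition factor {T : Type} (s : nat -> T) i n := mkseq (fun t => s (i + t)%N) n.

Lemma factor_cat T (s : nat -> T) i m n :
  factor s i (m + n) = factor s i m ++ factor s (i + m) n.
Proof.
rewrite /factor /mkseq iotaD map_cat add0n; congr (_ ++ _).
by rewrite -{1}[m]addn0 iotaDl -map_comp; apply: eq_map => t /=; rewrite addnA.
Qed.

(** The part of the shifted window beyond [i + n] repeats, by periodicity, the first [b] letters of
    the window at [i]. *)
Lemma rot_factor T (s : nat -> T) i n b :
  (forall k, (i <= k)%N -> s k = s (k + n)%N) -> (b <= n)%N ->
  factor s (i + b) n = rot b (factor s i n).
Proof.
move=> per bn; rewrite -{1}(subnK bn) -[in RHS](subnKC bn) !factor_cat.
have := rot_size_cat (factor s i b) (factor s (i + b) (n - b)).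
rewrite size_mkseq => ->; congr (_ ++ _).
rewrite -addnA subnKC//; apply: eq_mkseq => t.
by rewrite addnAC -per// leq_addr.
Qed.

Lemma word_powerSr T (u : seq T) k : word_power u k.+1 = word_power u k ++ u.
Proof.
elim: k => [|k IH]; first by rewrite /word_power /= cats0.
by rewrite -[LHS]/(u ++ word_power u k.+1) {1}IH catA.
Qed.

Lemma size_word_power T (u : seq T) k : size (word_power u k) = (k * size u)%N.
Proof. by elim: k => // k IH; rewrite word_powerSr size_cat IH mulSnr. Qed.

(** A power of [u] reads both as [u] followed by a power and as that power followed by [u];
    comparing letters gives the period. *)
Lemma periodic_of_factor_powers T (s : nat -> T) i (u : seq T) :
  (forall N, exists2 n, (N <= n)%N & exists k, factor s i n = word_power u k) ->
  (forall k, (i <= k)%N -> s k = s (k + size u)%N) /\ factor s i (size u) = u.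
Proof.
move=> pow; split=> [k ik|].
  (* This length puts both positions, [k - i] and [k - i + size u], inside the factor. *)
  have [n Nn [[|p] pE]] := pow (k - i + size u).+1.
    by have := congr1 size pE; rewrite size_mkseq => n0; rewrite n0 in Nn.
  have szn : n = (p * size u + size u)%N.
    by rewrite -mulSnr -size_word_power -pE size_mkseq.
  have lt : (k - i < p * size u)%N by move: Nn; rewrite szn -addSn leq_add2r.
  have nthE t : (t < n)%N -> s (i + t)%N = nth (s 0) (word_power u p.+1) t.
    by move=> tn; rewrite -pE nth_mkseq.
  rewrite -{1}(subnKC ik) -{2}(subnKC ik) -addnA !nthE//; last first.
    by rewrite (leq_trans _ Nn)// ltnS leq_addr.
  rewrite {1}word_powerSr nth_cat size_word_power lt.
  by rewrite -[word_power u p.+1]/(u ++ word_power u p) nth_cat ltnNge leq_addl addnK.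
have [n Nn [[|p] pE]] := pow (size u).
  have n0 : n = 0%N by have := congr1 size pE; rewrite size_mkseq.
  by move: Nn; rewrite n0 leqn0 => /nilP ->.
have := congr1 (take (size u)) pE.
rewrite -(subnKC Nn) factor_cat take_size_cat ?size_mkseq//.
by rewrite -[word_power u p.+1]/(u ++ word_power u p) take_size_cat.
Qed.

Lemma trajectory_add (R : realType) m d (A : 'I_m -> 'M[R]_d) s x0 i n :
  trajectory A s x0 (i + n) = word_prod A (factor s i n) *m trajectory A s x0 i.
Proof.
elim: n => [|n IH]; first by rewrite addn0 mul1mx.
rewrite addnS [LHS]/= IH mulmxA -[in RHS](addn1 n) factor_cat word_prod_cat.
have -> : factor s (i + n) 1 = [:: s (i + n)%N] by congr [:: s _]; rewrite addn0.
by rewrite [word_prod A [:: _]]mul1mx.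
Qed.

(** * Spectral radii of products and the dominance gap *)

Lemma le1_of_bounded_powers (R : realType) (x K : R) :
  (forall k, x ^+ k <= K) -> x <= 1.
Proof.
move=> xK; rewrite leNgt; apply/negP => x1.
have y0 : 0 < x - 1 by rewrite subr_gt0.
(* Bernoulli's inequality: the powers of [x > 1] grow at least linearly. *)
have bern k : (x - 1) *+ k <= x ^+ k.
  elim: k => [|k IH]; first by rewrite mulr0n ler01.
  have xk : 1 <= x ^+ k by rewrite exprn_ege1// ltW.
  rewrite mulrS exprS -[X in X * _](subrK 1) mulrDl mul1r lerD//.
  by rewrite ler_peMr// ltW.
have K0 : 0 <= K by rewrite (le_trans _ (xK 0%N))// expr0.
have := archi_boundP (divr_ge0 K0 (ltW y0)); set k := Num.bound _.
rewrite ltr_pdivrMr// mulr_natl => /(le_lt_trans (xK k)).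
by rewrite ltNge bern.
Qed.

Lemma spectral_radius_ge0 (R : realType) n (M : 'M[R]_n) : 0 <= spectral_radius M.
Proof.
have [[l Ml]|noM] := pselect (exists l, complex_eigenvalue M l).
  exact: le_trans (cmod_ge0 _ l) (cmod_le_spectral_radius _ _ _ _ Ml).
rewrite /spectral_radius (_ : [set _ | _ in _] = set0) ?sup0//.
by apply/seteqP; split=> // _ [l /= Ml _]; apply: noM; exists l.
Qed.

Section Dominance.
Context {R : realType} {m d : nat} (A : 'I_m -> 'M[R]_d) (c : R).
Context (Ac : forall w, `|word_prod A w| <= c).

(** Powers of an eigenvalue are eigenvalues of products of the repeated word, hence bounded by
    [d%:R * c]. *)
Lemma spectral_radius_word_le1 w : spectral_radius (word_prod A w) <= 1.
Proof.
apply: spectral_radius_le => // l wl; apply: (@le1_of_bounded_powers _ _ (d%:R * c)) => k.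
have : complex_eigenvalue (word_prod A (word_power w k)) (l ^+ k).
  apply: (complex_eigenvalueX _ _ (word_prod A w) l
    (fun k => word_prod A (word_power w k))) => // j.
  by rewrite word_powerSr word_prod_cat.
by move=> /cmod_eigenvalue_le; rewrite cmodX => /le_trans; apply; rewrite ler_wpM2l.
Qed.

Lemma averaged_radiusK w : w <> [::] ->
  averaged_radius A w ^+ size w = spectral_radius (word_prod A w).
Proof.
move=> w0; rewrite -powR_mulrn ?powR_ge0// -powRrM mulVf ?powRr1 ?spectral_radius_ge0//.
by rewrite pnatr_eq0 size_eq0; apply/eqP.
Qed.

Lemma dominant_gap P : dominant_set A P ->
  exists e : R, 0 < e < 1 /\ forall S, S <> [::] ->
    ~ (exists w j k, P w /\ S = word_power (rot j w) k) ->
    spectral_radius (word_prod A S) <= 1 - e.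
Proof.
move=> [[w Pw] _ _ _ [q [qP [e [e01 eP]]]]]; exists e; split=> // S S0 noS.
have q1 : 0 <= q <= 1.
  rewrite -(qP _ Pw) powR_ge0.
  rewrite (_ : 1 = 1 `^ (size w)%:R^-1); last by rewrite powR1.
  by rewrite ge0_ler_powR ?nnegrE ?spectral_radius_ge0 ?spectral_radius_word_le1.
have e1 : 0 <= 1 - e by rewrite subr_ge0 ltW; case/andP: e01.
have : averaged_radius A S <= (1 - e) `^ (size S)%:R^-1.
  by rewrite (le_trans (eP S S0 noS))// ler_piMr ?powR_ge0//; case/andP: q1.
move=> /(lerXn2r (size S)); rewrite !nnegrE !powR_ge0 => /(_ isT isT).
rewrite averaged_radiusK// -powR_mulrn ?powR_ge0// -powRrM mulVf ?powRr1//.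
by rewrite pnatr_eq0 size_eq0; apply/eqP.
Qed.

Lemma almost_fixed_dominant P : dominant_set A P ->
  exists2 delta : R, 0 < delta & forall S (z : 'cV[R]_d), S <> [::] ->
    `|word_prod A S *m z - z| < delta * `|z| ->
    exists w j k, P w /\ S = word_power (rot j w) k.
Proof.
move=> /dominant_gap[e [/andP[e0 _] eP]].
have c0 : 0 <= c by exact: le_trans (Ac [::]).
(* The constant of [det_sub1_almost_fixed], with [c + c] bounding [word_prod A S - 1%:M]; the added
   1 makes it positive. *)
pose K := d%:R * (d.-1`!%:R * (c + c) ^+ d.-1) + 1.
have K0 : 0 < K by rewrite ltr_wpDl// !mulr_ge0// exprn_ge0// addr_ge0.
exists (e ^+ d / K); first by rewrite divr_gt0// exprn_gt0.
move=> S z S0 zS; apply: contrapT => /(eP S S0) rS.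
have z0 : 0 < `|z|.
  rewrite lt_neqAle normr_ge0 andbT; apply: contraTN zS => /eqP <-.
  by rewrite mulr0 -leNgt.
have W1 : `|word_prod A S - 1%:M| <= c + c.
  by rewrite (le_trans (ler_normB _ _))// lerD//; exact: (Ac [::]).
have [|l /cmod_le_spectral_radius ll] :=
    complex_eigenvalue_near1 _ _ (word_prod A S) e (ltW e0).
  rewrite -(ltr_pM2r z0) (le_lt_trans (det_sub1_almost_fixed _ _ _ _ _ W1))//.
  rewrite (@le_lt_trans _ _ (K * `|word_prod A S *m z - z|))//.
    by rewrite ler_wpM2r// lerDl.
  by rewrite mulrC -ltr_pdivlMr// mulrAC.
by rewrite ltNge (le_trans ll).
Qed.

End Dominance.

(** * From recurrence of a trajectory to periodicity of its switching law *)

Theorem theorem6 (R : realType) (m d : nat) (A : 'I_m -> 'M[R]_d)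
    (P : set (seq 'I_m))
    (hirr : irreducible_family A)
    (hrho : joint_spectral_radius A = 1)
    (hfin : finite_set P)
    (hdom : dominant_set A P)
    (hlead : forall w, P w -> forall l : R[i],
       leading_eigenvalue (word_prod A w) l ->
       unique_simple_leading (word_prod A w) l)
    (s : nat -> 'I_m) (x0 : 'cV[R]_d) :
  ~ eventually_periodic_in P s ->
  trajectory A s x0 @ \oo --> (0 : 'cV[R]_d).
Proof.
move=> nper; apply: contrapT => ncvg; apply: nper.
have [c Ac] := bounded_products _ hirr hrho.
have [delta delta0 deltaP] := almost_fixed_dominant _ _ Ac _ hdom.
set x := trajectory A s x0 in ncvg *.
have [e e0 xe] : exists2 e, 0 < e & forall N, exists2 k, (N <= k)%N & e <= `|x k|.
  apply: contrapT => noe; apply: ncvg; apply/cvgr0Pnorm_lt => e e0.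
  have : ~ forall N, exists2 k, (N <= k)%N & e <= `|x k|.
    by move=> xe; apply: noe; exists e.
  move=> /existsNP[N noN]; exists N => // k /= Nk.
  by rewrite ltNge; apply/negP => ek; apply: noN; exists k.
have xb k : `|x k| <= d%:R * (c * `|x0|).
  rewrite /x -[k]add0n trajectory_add (le_trans (ler_norm_mulmx _ _ _ _ _ _))//.
  by rewrite ler_wpM2l// ler_wpM2r.
have [z zP] := cluster_subseq _ _ x _ _ xb xe.
(* Two returns within [eta] of [z] differ by less than [delta * e], at most [delta] times the norm
   of [x i]. *)
pose eta := delta * e / 2.
have eta0 : 0 < eta by rewrite divr_gt0// mulr_gt0.
have [i [_ ei zi]] := zP eta 0%N eta0.
have [ps PE] := (finite_seqP P).1 hfin.
pose us := [seq rot a w | w <- ps, a <- iota 0 (size w).+1].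
have [N|u] := seq_pigeonhole us (fun u n => exists k, factor s i n = word_power u k).
  (* Searching from [i + N.+1] on makes the factor longer than [N], in particular nonempty. *)
  have [j [Nj _ zj]] := zP eta (i + N.+1)%N eta0.
  have ij : (i <= j)%N by rewrite (leq_trans _ Nj)// leq_addr.
  have Nn : (N < j - i)%N by rewrite ltn_subRL -addnS.
  have [||w [a [k [Pw wE]]]] := deltaP (factor s i (j - i)) (x i).
  - by move=> /(congr1 size); rewrite size_mkseq => n0; rewrite n0 in Nn.
  - rewrite -trajectory_add subnKC// -/x -[x j](subrK z) -addrA.
    rewrite (le_lt_trans (ler_normD _ _))//.
    rewrite (@lt_le_trans _ _ (eta + eta)) ?ltrD// ?[`|z - _|]distrC//.
    by rewrite -splitr ler_wpM2l// ltW.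
  exists (j - i)%N; first exact: ltnW.
  exists (rot a w); last by exists k.
  rewrite PE /= in Pw; apply/allpairsPdep.
  (* A rotation by more than the length is the identity and is listed as the rotation by 0. *)
  have [aw|wa] := leqP a (size w); first by exists w, a; rewrite mem_iota.
  by exists w, 0%N; rewrite mem_iota rot0 rot_oversize// ltnW.
move=> /allpairsPdep[w [a [wps + uE]]] /periodic_of_factor_powers[per uF].
rewrite mem_iota ltnS /= => aw.
have szu : size u = size w by rewrite uE size_rot.
rewrite szu in per uF.
(* From [i] on the period reads [rot a w]; starting [size w - a] later completes the rotation and
   reads [w] itself, which is in [P]. *)
exists (size w), (i + (size w - a))%N; split=> [k ik|].
  by rewrite -per// (leq_trans _ ik)// leq_addr.
rewrite -/(factor s (i + (size w - a)) (size w)).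
rewrite rot_factor ?leq_subr// uF -szu -/(rotr a u) uE rotK.
by rewrite PE.
Qed.
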